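(* Let $f(x)=\sum_{\ell=1}^{d_f}\alpha_\ell x^\ell$ with $\alpha_1>0$, $\lambda(x)=\sum_{\ell=1}^{d_\lambda}\beta_\ell x^\ell$ with $\lambda(x)>0$ for $x>0$, $\gamma\in[0,1]$, where $d_f=\deg f\le d_\lambda=\deg\lambda$, and consider the infinite linear system $$\frac{d}{dt}\mu_m=\sum_{\ell=m}^{m+d_\lambda}C_{m,\ell}\,\mu_\ell,\qquad m=1,2,3,\dots$$ with the coefficients $C_{m,\ell}$ of the moment flow equations. This linear system does not generate a strongly continuous semigroup on any $\ell^p$ space (or, in fact, on any subspace of $\mathbb{R}^\infty$ that contains the vectors of finite support). Specifically, the ODE is ill-posed on any of these spaces.
   Context: The system is the moment flow of the one-state stochastic hybrid system with vector field $f$, jump rate $\lambda$ and reset $x\mapsto\gamma x$. With the conventions $\beta_0=0$, $\alpha_j=0$ for $j>d_f$, and $\beta_j=0$ for $j>d_\lambda$, its coefficients are $C_{m,m+j}=m\,\alpha_{j+1}+\beta_j(\gamma^m-1)$ for $0\le j\le d_\lambda$; in particular $C_{m,m}=m\alpha_1$ and $C_{m,m+d_\lambda}=\beta_{d_\lambda}(\gamma^m-1)$. Ill-posed: given a state space $X$ (with norm $|\cdot|$) and a flow map $\varphi$ on $X$, the flow is ill-posed if for any $x_0\in X$, any $t>0$ and any $\epsilon>0$ there is $y\in X$ with $|x_0-y|<\epsilon$ and $|\varphi(t,x_0)-\varphi(t,y)|>1$. An ODE is called ill-posed if its flow map is ill-posed. *)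

(* Defs.v *)
From HB Require Import structures.
From mathcomp Require Import all_boot all_order all_algebra.
From mathcomp Require Import all_classical all_reals all_analysis.

Set Implicit Arguments.
Unset Strict Implicit.
Unset Printing Implicit Defensive.

Import Order.TTheory GRing.Theory Num.Theory.
Import numFieldNormedType.Exports.

Local Open Scope classical_set_scope.
Local Open Scope ring_scope.

(* R^oo: the moment mu_m, m = 1, 2, 3, ..., is stored at index m.-1.
   [R^o] is [R] seen as a module over itself. *)
Notation Rinfty R := (nat -> R^o).

Definition finitely_supported (R : realType) (mu : Rinfty R) : Prop :=
  exists n : nat, forall m : nat, (n <= m)%N -> mu m = 0.

(* C_{m,l} for m <= l <= m + deg lam, with j = l - m.  The conventions
   alpha_j = 0 for j > deg f and beta_j = 0 for j > deg lam are those of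
   polynomial coefficients; beta_0 = 0 is a hypothesis on [lam]. *)
Definition moment_coef (R : realType) (f lam : {poly R}) (gamma : R)
    (m l : nat) : R :=
  m%:R * f`_(l - m).+1 + lam`_(l - m) * (gamma ^+ m - 1).

(* Row m = i.+1 of the system: the sum over m <= l <= m + deg lam. *)
Definition moment_field (R : realType) (f lam : {poly R}) (gamma : R)
    (mu : Rinfty R) : Rinfty R :=
  fun i => \sum_(i.+1 <= l < (i.+1 + (size lam).-1).+1)
             moment_coef f lam gamma i.+1 l * mu l.-1.

(* A normed subspace of R^oo is a normed module X together with an injective
   linear map [coord : X -> R^oo]; no compatibility between the norm and the
   coordinates is assumed. *)
Section Flow.
Context (R : realType) (X : normedModType R) (coord : X -> Rinfty R).
Context (F : Rinfty R -> Rinfty R).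

(* Continuous X-valued trajectories on [0, t] solving du/ds = F(u) coordinate
   by coordinate.  When, as for [moment_field], every coordinate of F involves
   finitely many coordinates of u, continuity of the coordinates makes the
   equation hold with one-sided derivatives at 0 and t as well. *)
Definition solution (t : R) (u : R -> X) : Prop :=
  [/\ {within `[0, t], continuous u},
      forall m, {within `[0, t], continuous (fun s => coord (u s) m)} &
      forall m s, s \in `]0, t[ ->
        is_derive s 1 (fun r => coord (u r) m) (F (coord (u s)) m)].

(* [ode_flow t x] is the set of states at time t of the solutions that start
   at x.  It is empty if no solution from x stays in X up to time t, which
   does happen for unbounded F, and is { phi(t, x) } when solutions exist and
   are unique. *)
Definition ode_flow (t : R) (x : X) : set X :=
  [set z | exists u : R -> X, [/\ solution t u, u 0 = x & u t = z]].

End Flow.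

(* Ill-posedness of a flow map, where [phi t x z] reads phi(t, x) = z; for
   (partial) flow maps the quantifiers over z and w only name phi(t, x0) and
   phi(t, y). *)
Definition ill_posed (R : realType) (X : normedModType R)
    (phi : R -> X -> set X) : Prop :=
  forall (x0 : X) (t e : R), 0 < t -> 0 < e ->
  forall z : X, phi t x0 z ->
  exists y w : X, [/\ phi t y w, `|x0 - y| < e & 1 < `|z - w|].

Definition ill_posed_ode (R : realType) (X : normedModType R)
    (coord : X -> Rinfty R) (F : Rinfty R -> Rinfty R) : Prop :=
  ill_posed (ode_flow coord F).

Section Semigroup.
Context (R : realType) (X : normedModType R).

(* T t is only meaningful for 0 <= t. *)
Record strongly_continuous_semigroup (T : R -> X -> X) : Prop := {
  semigroup_linear : forall t, 0 <= t -> linear (T t);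
  semigroup_bounded : forall t, 0 <= t -> continuous (T t);
  semigroup0 : forall x, T 0 x = x;
  semigroupD : forall s t x, 0 <= s -> 0 <= t -> T (s + t) x = T s (T t x);
  semigroup_strongly_continuous :
    forall x, {within `[0, +oo[, continuous (fun t => T t x)} }.

(* [generator T x y]: x is in the domain of the infinitesimal generator of T,
   which maps it to y. *)
Definition generator (T : R -> X -> X) (x y : X) : Prop :=
  h^-1 *: (T h x - x) @[h --> 0^'+] --> y.

(* The system dmu/dt = F(mu) generates a strongly continuous semigroup on X:
   some realisation of F in X, with a domain that contains the vectors of
   finite support, is the generator of such a semigroup.  This leaves the
   choice of the domain open; the maximal one, { x | F x in X }, is allowed. *)
Definition generates_semigroup (coord : X -> Rinfty R)
    (F : Rinfty R -> Rinfty R) : Prop :=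
  exists T : R -> X -> X,
  [/\ strongly_continuous_semigroup T,
      forall x y, generator T x y -> coord y = F (coord x) &
      forall x, finitely_supported (coord x) -> exists y, generator T x y].

End Semigroup.

(* l^p for 1 <= p <= +oo, as the library's L^p functions for the counting
   measure on nat.  The library equips [LfunType] with a seminorm; for the
   counting measure it is a norm. *)
Definition ellp (R : realType) (p : \bar R) (p1 : (1 <= p)%E) : Type :=
  LfunType (counting : {measure set nat -> \bar R}) p1.

Section Ellp.
Context (R : realType) (p : \bar R) (p1 : (1 <= p)%E).
Local Notation mu := (counting : {measure set nat -> \bar R}).

HB.instance Definition _ := GRing.Lmodule.copy (ellp p1) (LfunType mu p1).

Definition ellp_coord (x : ellp p1) : Rinfty R := (x : LfunType mu p1).

Definition ellp_norm (x : ellp p1) : R :=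
  fine ('N[mu]_p [EFin \o (ellp_coord x)])%E.

Lemma ellp_normD (x y : ellp p1) :
  ellp_norm (x + y) <= ellp_norm x + ellp_norm y.
Proof. exact: (ler_LnormD x y). Qed.

Lemma ellp_normZ (a : R) (x : ellp p1) :
  ellp_norm (a *: x) = `|a| * ellp_norm x.
Proof.
apply: EFin_inj; rewrite EFinM (finite_norm_fine (a *: x)) (finite_norm_fine x).
exact: LnormZ.
Qed.

Lemma ellp_norm0_eq0 (x : ellp p1) : ellp_norm x = 0 -> x = 0.
Proof.
move/(@fine_Lnormr_eq0 _ _ _ mu p p1 x) => [A [_ A0 sub]].
have A_empty : A = set0.
  move: A0; rewrite -[mu A]/(counting A) /counting.
  case: asboolP => // finA [] /eqP.
  by rewrite pnatr_eq0 finmap.cardfs_eq0 => /eqP /(fset_set_set0 finA).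
apply/LfuneqP => i; apply: contrapT => xi.
suff : A i by rewrite A_empty.
by apply: sub => /= /(_ I).
Qed.

HB.instance Definition _ :=
  Lmodule_isNormed.Build R (ellp p1) ellp_normD ellp_normZ ellp_norm0_eq0.

End Ellp.

(* Main.v *)
Require Import Defs.
From HB Require Import structures.
From mathcomp Require Import all_boot all_order all_algebra.
From mathcomp Require Import all_classical all_reals all_analysis.
From mathcomp Require Import ess_sup_inf.

Set Implicit Arguments.
Unset Strict Implicit.
Unset Printing Implicit Defensive.

Import Order.TTheory GRing.Theory Num.Theory.
Import numFieldNormedType.Exports.

Local Open Scope classical_set_scope.
Local Open Scope ring_scope.

(** The matrix of the moment system is upper triangular, so the vectors
supported on the first [n] coordinates form an invariant subspace, and its
diagonal entries [m * alpha_1], [m = 1, 2, ...], are pairwise distinct because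
[alpha_1 > 0].  Back substitution
([upper_triangular_eigenvector]) therefore yields, for every [m], an eigenvector
of finite support for the eigenvalue [m * alpha_1]: the operator has arbitrarily
large positive eigenvalues whose eigenvectors lie in every space under
consideration ([moment_field_eigenvector]).

Ill-posedness.  If [v] is an eigenvector for [a], adding [expR (a * s) *: v] to
a solution gives another solution ([solution_add_eigenvector]).  Rescale [v] to
norm [e / 2]: the initial data differ by [e / 2], the states at time [t] by
[expR (a * t) * e / 2], which exceeds 1 once [a] is large.  Only the homogeneity
of the norm enters, so the argument is the same in every space.

No semigroup.  Let [T] be a strongly continuous semigroup whose generator
extends the system on vectors of finite support.  Then
[T t v = expR (a * t) *: v] for each eigenvector [v] above
([semigroup_eigenvector]), hence the operator norm of [T 1] is at least
[expR a] for arbitrarily large [a], whereas [T 1] is bounded.  The formula for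
[T t v] holds because [expR (- a * s) *: T s v] has zero right derivative, and
a continuous function with zero right derivative is constant
([right_derivative0_constant]).

The spaces l^p are instances: their coordinate map is linear and injective, and
they contain the vectors of finite support ([finitely_supported_ellp]). *)

(** * Eigenvectors of triangular systems *)

(** Back substitution.  [S] is the strictly upper triangular part of [G].  The
vector is built downwards from coordinate [n], where it is 1; at row [i] the
equation [d i * v i + S v i = d n * v i] is solvable as [d i != d n]. *)
Lemma upper_triangular_eigenvector (K : fieldType)
    (G S : (nat -> K) -> nat -> K) (d : nat -> K) (n : nat) :
  (forall v i, G v i = d i * v i + S v i) ->
  (forall u v i, (forall j, (i < j)%N -> u j = v j) -> S u i = S v i) ->
  (forall v i, (forall j, (i < j)%N -> v j = 0) -> S v i = 0) ->
  (forall i, (i < n)%N -> d i != d n) ->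
  exists v, [/\ v n = 1, forall j, (n < j)%N -> v j = 0 &
                forall i, G v i = d n * v i].
Proof.
move=> GE Sloc S0 dn.
suff H k : (k <= n)%N -> exists v, [/\ v n = 1, forall j, (n < j)%N -> v j = 0 &
    forall i, (n - k <= i)%N -> G v i = d n * v i].
  have [v [vn v0 Gv]] := H n (leqnn n).
  by exists v; split => // i; apply: Gv; rewrite subnn.
elim: k => [_|k IH kn].
  exists (fun i => (i == n)%:R).
  split => [|j nj|i]; [by rewrite eqxx|by rewrite gtn_eqF|].
  rewrite subn0 leq_eqVlt GE => ni.
  rewrite S0 => [|j ij]; last first.
    have nj : (n < j)%N by apply: leq_ltn_trans ij; rewrite leq_eqVlt.
    by rewrite gtn_eqF.
  case/orP: ni => [/eqP <-|ni]; first by rewrite addr0 eqxx.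
  by rewrite gtn_eqF// !mulr0 addr0.
have [v [vn v0 Gv]] := IH (ltnW kn).
pose i0 := (n - k.+1)%N.
have i0n : (i0 < n)%N by rewrite /i0 ltn_subrL; case: n kn {Gv v0 vn IH dn i0}.
(* Solve row [i0] for its diagonal coordinate; the rows [i > i0], already
   satisfied, do not involve that coordinate. *)
exists (fun i => if i == i0 then S v i0 / (d n - d i0) else v i).
split => [|j nj|i i0i].
- by rewrite gtn_eqF.
- by rewrite gtn_eqF ?v0// (ltn_trans i0n).
- rewrite GE (Sloc _ v) => [|j ij]; last first.
    by rewrite gtn_eqF// (leq_ltn_trans i0i).
  case: eqP => [->|/eqP ii0].
    have /mulfVK e : d n - d i0 != 0 by rewrite subr_eq0 eq_sym dn.
    by rewrite -[X in _ + X]e [X in _ + X]mulrC -mulrDl addrC subrK.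
  rewrite -GE Gv//; move: i0i; rewrite leq_eqVlt eq_sym (negPf ii0)/=.
  by rewrite /i0 subnS prednK// subn_gt0.
Qed.

(** * The moment system *)

Section MomentField.
Context (R : realType) (f lam : {poly R}) (gamma : R).
Local Notation F := (moment_field f lam gamma).

Lemma moment_field_linear (a : R) (u v : Rinfty R) (m : nat) :
  F (u + a *: v) m = F u m + a * F v m.
Proof.
rewrite /moment_field mulr_sumr -big_split; apply: eq_bigr => l _ /=.
rewrite [(u + a *: v) l.-1]/(u l.-1 + a * v l.-1).
by rewrite mulrDr mulrCA.
Qed.

(** The diagonal entry of row [m] is [m * alpha_1]: the contribution of the
jumps to it carries the factor [beta_0 = 0]. *)
Lemma moment_field_eigenvector (n : nat) : 0 < f`_1 -> lam`_0 = 0 ->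
  exists v : Rinfty R, [/\ finitely_supported v, v <> 0 &
    F v = (n.+1%:R * f`_1) *: v].
Proof.
move=> f1 lam0.
pose S (v : nat -> R) i := \sum_(i.+2 <= l < (i.+1 + (size lam).-1).+1)
  moment_coef f lam gamma i.+1 l * v l.-1.
have FE (v : nat -> R) i : F v i = (i.+1%:R * f`_1) * v i + S v i.
  by rewrite /moment_field big_ltn ?ltnS ?leq_addr// /moment_coef subnn lam0
    mul0r addr0.
have Sloc (u v : nat -> R) i :
    (forall j, (i < j)%N -> u j = v j) -> S u i = S v i.
  move=> uv; apply: eq_big_nat => -[//|l] /andP[il _] /=.
  by rewrite uv.
have S0 (v : nat -> R) i : (forall j, (i < j)%N -> v j = 0) -> S v i = 0.
  by move=> v0; rewrite (Sloc _ (fun=> 0))// /S big1// => l _; rewrite mulr0.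
have dn i : (i < n)%N -> (i.+1%:R * f`_1 : R) != n.+1%:R * f`_1.
  by move=> i_n; rewrite lt_eqF// ltr_pM2r// ltr_nat.
have [v [vn v0 Fv]] := upper_triangular_eigenvector FE Sloc S0 dn.
exists v; split; first by exists n.+1 => m; exact: v0.
  by move=> /(congr1 (fun w : nat -> R => w n))/eqP; rewrite vn oner_eq0.
exact/funext.
Qed.

End MomentField.

(** * Real exponentials and right derivatives *)

Lemma expR_exceeds (R : realType) (a t M : R) : 0 < a -> 0 < t ->
  exists n : nat, M < expR (n.+1%:R * a * t).
Proof.
move=> a0 t0.
pose k := Num.bound (`|M| / (a * t)).
have at0 : 0 < a * t by rewrite mulr_gt0.
exists k; have := expR_ge1Dx (k.+1%:R * a * t); apply: lt_le_trans.
apply: le_lt_trans (ler_norm M) _.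
apply: (@lt_trans _ _ (k%:R * (a * t))).
  by rewrite -ltr_pdivrMr// /k archi_boundP// divr_ge0// ltW.
by rewrite -mulrA ltr_wpDl// ltr_pM2r// ltr_nat ltnS.
Qed.

(** A mean value argument with one-sided information.  For [e > 0], the
set [A] of times [s <= t] such that [`|u s - u 0| <= e * s] contains its
supremum by continuity, and a supremum smaller than [t] could be increased
because the right derivative there is 0; so [t] is in [A], for every [e]. *)
Lemma right_derivative0_constant (R : realType) (V : normedModType R)
    (u : R -> V) :
  {within `[0, +oo[, continuous u} ->
  (forall s, 0 <= s -> forall e, 0 < e ->
     \forall h \near (0 : R)^'+, `|u (s + h) - u s| <= e * h) ->
  forall t, 0 <= t -> u t = u 0.
Proof.
move=> /continuous_within_itvcyP[cu _] du t t0.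
apply/eqP; rewrite -subr_eq0 -normr_le0; apply/ler_addgt0Pr => e' e'0.
rewrite add0r.
(* Dividing by [t + 1] rather than [t] covers [t = 0]. *)
pose e := e' / (t + 1).
have t1 : 0 < t + 1 by rewrite ltr_pwDr.
have e0 : 0 < e by rewrite divr_gt0.
suff : `|u t - u 0| <= e * t.
  move=> /le_trans; apply; rewrite /e mulrAC ler_pdivrMr// ler_pM2l//.
  by rewrite lerDl.
pose A := [set s | 0 <= s <= t /\ `|u s - u 0| <= e * s].
have A0 : A 0 by split; rewrite ?lexx ?t0// subrr normr0 mulr0.
have hsA : has_sup A.
  by split; [exists 0|exists t => s [/andP[]]].
have supA : A (sup A).
  have c0 : 0 <= sup A by apply: ub_le_sup => //; case: hsA.
  have ct : sup A <= t by apply: ge_sup; [exists 0|move=> s [/andP[]]].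
  split; first by rewrite c0 ct.
  move: c0; rewrite le_eqVlt => /predU1P[<-|c0]; first by case: A0.
  rewrite leNgt; apply/negP => cA.
  have : \forall s \near sup A, e * s < `|u s - u 0|.
    have cg : {for sup A, continuous (fun s => `|u s - u 0| - e * s)}.
      apply: cvgB; last by apply: cvgM; [exact: cvg_cst|exact: cvg_id].
      apply: cvg_norm; apply: cvgB; last exact: cvg_cst.
      by apply: cu; rewrite in_itv/= andbT.
    have := cvgr_gt _ cg 0; rewrite subr_gt0 => /(_ _ cA).
    by apply: filterS => s; rewrite subr_gt0.
  have /(_ _ _)/[apply] := @closure_sup R A (ex_intro _ 0 A0) (proj2 hsA).
  by move=> [s [[_ As]]]/=; rewrite ltNge As.
have ct : sup A <= t by case: supA => /andP[].
have [|ct'] := leP t (sup A).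
  move=> tc; have <- : sup A = t by apply/eqP; rewrite eq_le ct tc.
  by case: supA.
case: supA => /andP[c0 _] Ac.
have /filter_ex[] : \forall h \near (0 : R)^'+, A (sup A + h) /\ 0 < h.
  near=> h.
  have h0 : 0 < h by near: h; exact: nbhs_right_gt.
  split => //; split.
    rewrite addr_ge0 ?(ltW h0)//= addrC -lerBrDr; near: h.
    by apply: nbhs_right_le; rewrite subr_gt0.
  apply: le_trans (ler_distD (u (sup A)) _ _) _.
  by rewrite mulrDr [leRHS]addrC lerD//; near: h; exact: du.
move=> h [Ah h0].
by have := ub_le_sup (proj2 hsA) Ah; rewrite gerDl leNgt h0.
Unshelve. all: by end_near. Qed.

Lemma is_derive_expR_scale (R : realType) (a s : R) :
  is_derive s 1 (fun r => expR (a * r)) (a * expR (a * s)).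
Proof.
have da : is_derive s (1 : R) (fun r : R => a * r) a.
  have := is_deriveZ (f := id) a (is_derive_id s (1 : R)).
  by rewrite [a *: 1]mulr1.
by have := is_derive1_comp (is_derive_expR (a * s)) da; rewrite mulrC.
Qed.

Lemma continuous_expR_scale (R : realType) (a : R) :
  continuous (fun s : R => expR (a * s)).
Proof.
move=> s; apply: differentiable_continuous; apply/derivable1_diffP.
by case: (is_derive_expR_scale a s).
Qed.

(** * Semigroups on eigenvectors of their generator *)

Lemma semigroup_linear_map (R : realType) (X : normedModType R)
    (T : R -> X -> X) (s : R) :
  strongly_continuous_semigroup T -> 0 <= s ->
  exists2 L : {linear X -> X}, T s = L & continuous L.
Proof.
move=> semT s0; have := semigroup_linear semT s0.
have := semigroup_bounded semT s0; move: (T s) => Ts cTs linTs.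
pose linM := GRing.isLinear.Build R X X *:%R Ts linTs.
by exists (HB.pack Ts linM : {linear X -> X}).
Qed.

(** [expR (- a * s) *: T s x] is the orbit of [x] under the rescaled semigroup,
whose generator maps [x] to [a *: x - a *: x = 0]; hence this orbit has zero
right derivative and is constant. *)
Lemma semigroup_eigenvector (R : realType) (X : normedModType R)
    (T : R -> X -> X) (a : R) (x : X) :
  strongly_continuous_semigroup T -> generator T x (a *: x) ->
  forall t, 0 <= t -> T t x = expR (a * t) *: x.
Proof.
move=> semT genx t t0.
pose u s : X := expR (- a * s) *: T s x.
suff ut : u t = u 0.
  move: ut; rewrite /u mulr0 expR0 scale1r (semigroup0 semT) => ut.
  by rewrite -[X in _ *: X]ut scalerA -expRD -mulrDl subrr mul0r expR0 scale1r.
have cexp := @continuous_expR_scale R (- a).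
apply: (right_derivative0_constant (u := u)) => //.
  move=> s; apply: cvgZ; last exact: (semigroup_strongly_continuous semT).
  exact: (continuous_subspaceT cexp).
move=> s s0 e e0.
have [L TsL cL] := semigroup_linear_map semT s0.
(* The semigroup law reduces the increment at [s] to the increment at 0. *)
have uD h : 0 <= h -> u (s + h) - u s =
    expR (- a * s) *: T s (expR (- a * h) *: T h x - x).
  move=> h0; rewrite /u (semigroupD semT _ s0 h0) TsL.
  by rewrite (linearB L) (linearZ_LR L) scalerBr scalerA -expRD mulrDr.
have dq : h^-1 *: (expR (- a * h) *: T h x - x) @[h --> (0 : R)^'+] --> (0 : X).
  have Dexp : h^-1 *: (expR (- a * h) - 1) @[h --> (0 : R)^'+] --> (- a : R^o).
    apply: cvg_dnbhs_at_right.
    have [cvD valD] := is_derive_expR_scale (- a) 0.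
    rewrite mulr0 expR0 mulr1 in valD.
    have {valD}: h^-1 *: (((fun r => expR (- a * r)) \o shift 0) (h *: 1) -
        expR (- a * 0)) @[h --> (0 : R)^'] --> (- a : R^o).
      by rewrite -[X in _ --> X]valD; exact: cvD.
    rewrite mulr0 expR0; under eq_fun do rewrite /= addr0 [_ *: 1]mulr1.
    exact.
  have -> : (0 : X) = 1 *: (a *: x) + (- a) *: x.
    by rewrite scale1r scaleNr subrr.
  rewrite (_ : (fun h => _) = (fun h : R =>
      expR (- a * h) *: (h^-1 *: (T h x - x)) +
      (h^-1 *: (expR (- a * h) - 1)) *: x)); last first.
    apply/funext => h.
    rewrite [h^-1 *: (_ - 1)]/(h^-1 * (_ - 1)) -[(h^-1 * _) *: x]scalerA.
    rewrite [expR _ *: (_ *: _)]scalerA [_ * h^-1]mulrC -scalerA -scalerDr.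
    by congr (_ *: _); rewrite scalerBr scalerBl scale1r addrA subrK.
  apply: cvgD; last by apply: cvgZ; [exact: Dexp|exact: cvg_cst].
  apply: cvgZ; last exact: genx.
  rewrite -[X in _ --> X]expR0 -[X in _ --> expR X](mulr0 (- a)).
  by apply: cvg_at_right_filter; exact: cexp.
have dqs : L (h^-1 *: (expR (- a * h) *: T h x - x)) @[h --> (0 : R)^'+] -->
    (0 : X).
  by rewrite -(linear0 L); apply: continuous_cvg dq; exact: cL.
have eK : 0 < e / expR (- a * s) by rewrite divr_gt0// expR_gt0.
have /cvgr0Pnorm_le/(_ _ eK) := dqs.
apply: filterS2 (nbhs_right_gt 0) => h h0.
rewrite linearZ_LR normrZ gtr0_norm ?invr_gt0// mulrC ler_pdivrMr// => Lh.
rewrite uD ?(ltW h0)// normrZ gtr0_norm ?expR_gt0// TsL.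
by rewrite mulrC -ler_pdivlMr ?expR_gt0// mulrAC.
Qed.

(** [expR a] is an eigenvalue of the bounded operator [T 1], so [M] can be any
bound of [T 1]. *)
Lemma semigroup_eigenvalues_bounded (R : realType) (X : normedModType R)
    (T : R -> X -> X) :
  strongly_continuous_semigroup T ->
  exists M : R, forall (a : R) (x : X),
    x <> 0 -> generator T x (a *: x) -> expR a <= M.
Proof.
move=> semT; have [L T1L cL] := semigroup_linear_map semT ler01.
have /linear_boundedP/pinfty_ex_gt0[M M0 LM] :=
  continuous_linear_bounded 0 (cL 0).
exists M => a x /eqP x0 gx; have := LM x.
rewrite -T1L (semigroup_eigenvector semT gx)// mulr1 normrZ.
by rewrite ger0_norm ?expR_ge0// ler_pM2r// normr_gt0.
Qed.

(** * Instability along eigenvectors *)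

Section IllPosed.
Context (R : realType) (X : normedModType R) (coord : {linear X -> Rinfty R}).
Context (F : Rinfty R -> Rinfty R).
Context (F_linear : forall (a : R) u v m, F (u + a *: v) m = F u m + a * F v m).

Lemma solution_add_eigenvector (t a : R) (x : X) (u : R -> X) :
  F (coord x) = a *: coord x -> solution coord F t u ->
  solution coord F t (fun s => u s + expR (a * s) *: x).
Proof.
move=> Fx [cu cum du].
have cexp := @continuous_expR_scale R a.
have coordE m : (fun s => coord (u s + expR (a * s) *: x) m) =
    (fun s => coord (u s) m + expR (a * s) * coord x m).
  by apply/funext => s; rewrite linearD linearZ_LR.
split.
- move=> s; apply: cvgD; first exact: cu.
  by apply: cvgZ; [exact: (continuous_subspaceT cexp)|exact: cvg_cst].
- move=> m /=; rewrite coordE.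
  move=> s; apply: cvgD; first exact: cum.
  by apply: cvgM; [exact: (continuous_subspaceT cexp)|exact: cvg_cst].
- move=> m s st /=; rewrite coordE.
  rewrite linearD linearZ_LR F_linear Fx.
  have := is_deriveD (du m s st)
    (is_deriveZ (coord x m) (is_derive_expR_scale a s)).
  rewrite [_ *: (a * _)]mulrCA [coord x m * _]mulrC mulrCA.
  by congr is_derive; apply/funext => r; congr (_ + _); rewrite mulrC.
Qed.

(** A perturbation of the initial state along an eigenvector for [a] is
amplified by [expR (a * t)] up to time [t], so arbitrarily large eigenvalues
prevent any continuous dependence on the initial state. *)
Lemma eigenvectors_ill_posed :
  (forall t M : R, 0 < t -> exists a x,
     [/\ M < expR (a * t), x <> 0 & F (coord x) = a *: coord x]) ->
  ill_posed_ode coord F.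
Proof.
move=> eig x0 t e t0 e0 z [u [su u0 ut]].
(* With a perturbation of norm [e / 2], the final states are at distance more
   than 1 as soon as [expR (a * t)] exceeds [2 / e]. *)
have [a [x [ax /eqP x_neq0 Fx]]] := eig t (2 / e) t0.
have nx : 0 < `|x| by rewrite normr_gt0.
have e2 : 0 < e / 2 by rewrite divr_gt0.
pose y := (e / 2 / `|x|) *: x.
have ny : `|y| = e / 2.
  by rewrite normrZ gtr0_norm ?divr_gt0// divfK// gt_eqF.
have Fy : F (coord y) = a *: coord y.
  apply/funext => m; rewrite linearZ_LR -[X in F X]add0r F_linear Fx.
  have := F_linear (- 1) 0 0 m; rewrite scaler0 addr0 mulN1r subrr => ->.
  by rewrite add0r; exact: mulrCA.
exists (x0 + y), (z + expR (a * t) *: y); split.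
- exists (fun s => u s + expR (a * s) *: y); split.
  + exact: solution_add_eigenvector.
  + by rewrite u0 mulr0 expR0 scale1r.
  + by rewrite ut.
- by rewrite opprD addNKr normrN ny ltr_pdivrMr// ltr_pMr// ltr1n.
- rewrite opprD addNKr normrN normrZ ny gtr0_norm ?expR_gt0//.
  by rewrite -ltr_pdivrMr// div1r invf_div.
Qed.

End IllPosed.

(** * The moment flow *)

(** The same eigenvectors, with eigenvalues [m * alpha_1], serve both claims:
their finite support puts them in [X] and in the domain of any candidate
generator. *)
Lemma moment_flow_ill_posed (R : realType) (f lam : {poly R}) (gamma : R)
    (X : normedModType R) (coord : {linear X -> Rinfty R}) :
  0 < f`_1 -> lam`_0 = 0 -> injective coord ->
  (forall mu : Rinfty R, finitely_supported mu -> exists x : X, coord x = mu) ->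
  ~ generates_semigroup coord (moment_field f lam gamma)
  /\ ill_posed_ode coord (moment_field f lam gamma).
Proof.
move=> f1 lam0 inj_coord finX; set F := moment_field f lam gamma.
have eig (t M : R) : 0 < t -> exists a x, [/\ M < expR (a * t), x <> 0,
    finitely_supported (coord x) & F (coord x) = a *: coord x].
  move=> t0; have [n Mn] := expR_exceeds M f1 t0.
  have [v [fv v0 Fv]] := moment_field_eigenvector gamma n f1 lam0.
  have [x xv] := finX v fv.
  exists (n.+1%:R * f`_1), x; rewrite xv; split => // x0.
  by apply: v0; rewrite -xv x0 linear0.
split; last first.
  apply: eigenvectors_ill_posed => [a u v m|t M /(eig _ M)[a [x [? ? _ ?]]]].
    exact: moment_field_linear.
  by exists a, x.
move=> [T [semT genF domT]].
have [M expM] := semigroup_eigenvalues_bounded semT.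
have [a [x [aM x0 fx Fx]]] := eig 1 M ltr01.
have [y gy] := domT x fx.
have ya : y = a *: x by apply: inj_coord; rewrite (genF _ _ gy) Fx linearZ_LR.
by move: aM; rewrite mulr1 ltNge (expM _ _ x0)// -ya.
Qed.

(** * The spaces l^p *)

Section EllpFinite.
Context (R : realType) (p : \bar R) (p1 : (1 <= p)%E).

Lemma ellp_coord_linear : linear (@ellp_coord R p p1).
Proof. by []. Qed.

HB.instance Definition _ :=
  GRing.isLinear.Build R (ellp p1) (Rinfty R) *:%R (@ellp_coord R p p1)
    ellp_coord_linear.

Lemma ellp_coord_inj : injective (@ellp_coord R p p1).
Proof.
move=> x y xy; apply/LfuneqP => m.
by move/(congr1 (fun g : nat -> R => g m)): xy.
Qed.

(** For [p] finite the integral defining the norm is a finite sum of real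
numbers; for [p] infinite the essential supremum is at most the sum of the
absolute values. *)
Lemma finitely_supported_ellp (v : Rinfty R) :
  finitely_supported v -> exists x : ellp p1, ellp_coord x = v.
Proof.
move=> [n v0].
suff vL : (v : nat -> R) \in Lfun (counting : {measure set nat -> \bar R}) p.
  by exists (Lfun_Sub p1 vL : LfunType _ p1).
apply/andP; split; first by rewrite inE.
rewrite inE /finite_norm /=.
case: p p1 => [r r1||//].
  have r0 : 0 < r by rewrite (lt_le_trans ltr01)// -lee_fin.
  rewrite Lnorm_counting//; apply: poweR_lty.
  rewrite (nneseries_split _ n); last by move=> k _; exact: poweR_ge0.
  rewrite [X in (_ + X)%E]eseries0 ?adde0; last first.
    by move=> k nk _ /=; rewrite v0// normr0 powR0// gt_eqF.
  by apply: lte_sum_pinfty => k _; apply: poweR_lty; exact: ltry.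
move=> _; rewrite unlock /Lnorm; case: ifP => // _.
apply: (@le_lt_trans _ _ (\sum_(i < n) `|v i|)%:E); last exact: ltry.
apply/ess_supP; apply: nearW => k /=; rewrite lee_fin.
have [nk|kn] := leqP n k; first by rewrite v0// normr0 sumr_ge0.
by rewrite (bigD1 (Ordinal kn))//= lerDl sumr_ge0.
Qed.

End EllpFinite.

Theorem proposition3p3 (R : realType) (f lam : {poly R}) (gamma : R)
    (f_0 : f`_0 = 0) (alpha1_gt0 : 0 < f`_1)
    (lam_0 : lam`_0 = 0) (lam_gt0 : forall x : R, 0 < x -> 0 < lam.[x])
    (gamma_ge0 : 0 <= gamma) (gamma_le1 : gamma <= 1)
    (deg_le : ((size f).-1 <= (size lam).-1)%N) :
  (forall (p : \bar R) (p1 : (1 <= p)%E),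
      ~ generates_semigroup (@ellp_coord R p p1) (moment_field f lam gamma)
   /\ ill_posed_ode (@ellp_coord R p p1) (moment_field f lam gamma))
  /\
  (forall (X : normedModType R) (coord : {linear X -> Rinfty R}),
      injective coord ->
      (forall mu : Rinfty R, finitely_supported mu -> exists x : X, coord x = mu) ->
      ~ generates_semigroup coord (moment_field f lam gamma)
   /\ ill_posed_ode coord (moment_field f lam gamma)).
Proof.
split=> [p p1|X coord inj_coord finX]; last exact: moment_flow_ill_posed.
apply: (@moment_flow_ill_posed _ _ _ _ _ (@ellp_coord R p p1)) => //.
- exact: ellp_coord_inj.
- exact: finitely_supported_ellp.
Qed.
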